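(* Let $\mathbf A=(A;w)$ be a finite algebra whose only basic operation $w$ is a weak near-unanimity operation, let ${\sim}$ be a maximal congruence of $\mathbf A$ which is Abelian and satisfies $\mathrm{typ}({\sim},1_{\mathbf A})=\mathbf 5$. If there is a largest ${\sim}$-class with respect to the order $\le$ described below, then there is a binary term operation $\wedge$ of $\mathbf A$ such that $(A/{\sim};\wedge)$ is a semilattice and on each ${\sim}$-class the restriction of $\wedge$ is the second projection.
   Context: An $n$-ary operation $w$ is a weak near-unanimity operation if it is idempotent and satisfies $w(x,\dots,x,y)=w(x,\dots,x,y,x)=\dots=w(y,x,\dots,x)$. Types are those of tame congruence theory. Order on $A/{\sim}$: for every $({\sim},1_{\mathbf A})$-minimal set $U$ (whose body is all of $U$), $U$ meets exactly two ${\sim}$-classes $C_1,C_2$, and the polynomial operations of $\mathbf A$ restricted to $U$ induce a two-element semilattice on $\{C_1\cap U,C_2\cap U\}$ modulo ${\sim}$; declare $C_1$ below $C_2$ if $C_1\cap U$ is the bottom of this semilattice. $\le$ is the reflexive-transitive closure of these relations over all minimal sets; it is a connected partial order on $A/{\sim}$. *)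

(* Defs.v *)
From Stdlib Require Import Relation_Operators.
From HB Require Import structures.
From mathcomp Require Import all_boot generic_quotient.

Set Implicit Arguments.
Unset Strict Implicit.
Unset Printing Implicit Defensive.

Local Open Scope quotient_scope.

(* An algebra with universe T, of an arbitrary (possibly infinite) signature. *)
Record algebra (T : Type) := Algebra {
  symb : Type;
  arity : symb -> nat;
  op : forall s : symb, {ffun 'I_(arity s) -> T} -> T }.

Definition alg1 (T : Type) (n : nat) (f : {ffun 'I_n -> T} -> T) : algebra T :=
  @Algebra T unit (fun=> n) (fun=> f).

Definition binop (T : Type) (m : T -> T -> T) : {ffun 'I_2 -> T} -> T :=
  fun x => m (x ord0) (x ord_max).

Section Clones.
Variables (T : Type) (A : algebra T).

Inductive term (V : Type) : Type :=
| Var of V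
| App (s : symb A) of ('I_(arity s) -> term V).

Fixpoint eval (V : Type) (e : V -> T) (t : term V) : T :=
  match t with
  | Var v => e v
  | App s ts => op [ffun i => eval e (ts i)]
  end.

Definition is_term_op (n : nat) (f : {ffun 'I_n -> T} -> T) : Prop :=
  exists t : term 'I_n, forall x, f x = eval x t.

(* Polynomial operations: terms over variables 'I_n and constants from T. *)
Definition is_pol_op (n : nat) (f : {ffun 'I_n -> T} -> T) : Prop :=
  exists t : term ('I_n + T), forall x : {ffun 'I_n -> T},
    f x = eval (fun v => match v with inl i => x i | inr a => a end) t.

Definition is_pol1 (f : T -> T) : Prop :=
  is_pol_op (fun x : {ffun 'I_1 -> T} => f (x ord0)).

End Clones.

Definition pol_equivalent (T : Type) (A B : algebra T) : Prop :=
  forall (n : nat) (f : {ffun 'I_n -> T} -> T), is_pol_op A f <-> is_pol_op B f.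

Definition is_semilattice (T : Type) (m : T -> T -> T) : Prop :=
  [/\ associative m, commutative m & forall x, m x x = x].

Definition two_element (T : Type) : Prop :=
  exists a b : T, a <> b /\ forall c, c = a \/ c = b.

Definition is_wnu (T : Type) (n : nat) (w : {ffun 'I_n -> T} -> T) : Prop :=
  (forall x, w [ffun=> x] = x) /\
  (forall (x y : T) (i j : 'I_n),
      w [ffun k => if k == i then y else x] =
      w [ffun k => if k == j then y else x]).

Section Congruences.
Variables (T : choiceType) (A : algebra T).

Definition is_congruence (r : equiv_rel T) : Prop :=
  forall (s : symb A) (x y : {ffun 'I_(arity s) -> T}),
    (forall i, r (x i) (y i)) -> r (op x) (op y).

Lemma one_equiv_axiom : equiv_class_of (fun _ _ : T => true).
Proof. by split. Qed.
Definition one_cong : equiv_rel T := EquivRelPack one_equiv_axiom.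

Definition is_maximal_congruence (r : equiv_rel T) : Prop :=
  [/\ is_congruence r,
      ~ (r =2 one_cong)
    & forall r' : equiv_rel T, is_congruence r' -> subrel r r' ->
        ~ (r' =2 one_cong) -> r' =2 r].

Definition is_prime_quotient (a b : equiv_rel T) : Prop :=
  [/\ is_congruence a, is_congruence b, subrel a b, ~ (a =2 b)
    & forall c : equiv_rel T, is_congruence c -> subrel a c -> subrel c b ->
        c =2 a \/ c =2 b].

Definition fcons (n : nat) (u : T) (x : {ffun 'I_n -> T}) :
    {ffun 'I_n.+1 -> T} :=
  [ffun i => if unlift ord0 i is Some j then x j else u].

(* The centrality relation C(a, b; c). *)
Definition centralizes (a b c : rel T) : Prop :=
  forall (n : nat) (f : {ffun 'I_n.+1 -> T} -> T), is_pol_op A f ->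
  forall (u v : T) (x y : {ffun 'I_n -> T}),
    a u v -> (forall i, b (x i) (y i)) ->
    c (f (fcons u x)) (f (fcons u y)) <-> c (f (fcons v x)) (f (fcons v y)).

Definition is_abelian_congruence (r : equiv_rel T) : Prop :=
  is_congruence r /\ centralizes r r eq_op.

(* Representatives are used to define the induced operations; this agrees with
   the usual quotient whenever r is compatible with the operation. *)
Definition quot_binop (r : equiv_rel T) (m : T -> T -> T) :
    {eq_quot r} -> {eq_quot r} -> {eq_quot r} :=
  fun c d => \pi_{eq_quot r} (m (repr c) (repr d)).

Definition quot_alg (r : equiv_rel T) : algebra {eq_quot r} :=
  @Algebra {eq_quot r} (symb A) (@arity _ A)
    (fun s x => \pi_{eq_quot r} (op (s := s) [ffun i => repr (x i)])).

End Congruences.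

Section Induced.
Variables (T : finType) (A : algebra T) (N : {set T}).

Record induced_symb := InducedSymb {
  ind_arity : nat;
  ind_fun : {ffun 'I_ind_arity -> T} -> T;
  ind_pol : is_pol_op A ind_fun;
  ind_closed : forall x : {ffun 'I_ind_arity -> T},
    (forall i, x i \in N) -> ind_fun x \in N }.

Lemma ind_op_subproof (s : induced_symb)
    (x : {ffun 'I_(ind_arity s) -> {x : T | x \in N}}) :
  ind_fun [ffun i => val (x i)] \in N.
Proof. by apply: ind_closed => i; rewrite ffunE; exact: valP. Qed.

(* The induced algebra A|_N: all polynomials of A that preserve N. *)
Definition induced_alg : algebra {x : T | x \in N} :=
  @Algebra {x : T | x \in N} induced_symb ind_arity
    (fun s x => exist (fun y : T => y \in N) _ (ind_op_subproof x)).

Variable r : equiv_rel T.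

Lemma restr_equiv_axiom :
  equiv_class_of (fun x y : {x : T | x \in N} => r (val x) (val y)).
Proof.
split=> [x|x y|y x z]; [exact: equiv_refl | exact: equiv_sym | exact: equiv_trans].
Qed.
Definition restr_equiv : equiv_rel {x : T | x \in N} :=
  EquivRelPack restr_equiv_axiom.

(* (A|_N) / (r|_N) is polynomially equivalent to the two-element semilattice
   with operation m. *)
Definition induces_semilattice
    (m : {eq_quot restr_equiv} -> {eq_quot restr_equiv} ->
         {eq_quot restr_equiv}) : Prop :=
  [/\ two_element {eq_quot restr_equiv},
      is_semilattice m
    & pol_equivalent (quot_alg induced_alg restr_equiv) (alg1 (binop m))].

End Induced.

Section Tame.
Variables (T : finType) (A : algebra T).

(* Sets f(T), for f a unary polynomial with f(b) not contained in a. *)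
Definition separating_image (a b : equiv_rel T) (U : {set T}) : Prop :=
  exists f : T -> T,
    [/\ is_pol1 A f, U = [set f x | x in [set: T]]
      & exists x y, b x y /\ ~~ a (f x) (f y)].

Definition is_minimal_set (a b : equiv_rel T) (U : {set T}) : Prop :=
  separating_image a b U /\
  forall V : {set T}, separating_image a b V -> V \subset U -> V = U.

Definition is_trace (a b : equiv_rel T) (N : {set T}) : Prop :=
  exists (U : {set T}) (x : T),
    [/\ is_minimal_set a b U, x \in U, N = [set y in U | b x y]
      & exists2 y, y \in N & ~~ a x y].

Definition has_type5 (a b : equiv_rel T) : Prop :=
  is_prime_quotient A a b /\
  forall N : {set T}, is_trace a b N ->
    exists m, induces_semilattice A (N := N) (r := a) m.

(* One generating pair c1 < c2: c1 and c2 are the two r-classes met by a minimal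
   set U, and c1 gives the bottom (absorbing) element of the meet semilattice
   induced on U / (r|_U). *)
Definition class_below (r : equiv_rel T) (c1 c2 : {eq_quot r}) : Prop :=
  exists (U : {set T}) (m : {eq_quot restr_equiv U r} ->
            {eq_quot restr_equiv U r} -> {eq_quot restr_equiv U r}),
    [/\ is_minimal_set r (one_cong T) U,
        induces_semilattice A (N := U) (r := r) m
      & exists u1 u2 : {x : T | x \in U},
          [/\ c1 = \pi_{eq_quot r} (val u1), c2 = \pi_{eq_quot r} (val u2), c1 <> c2
            & m (\pi_{eq_quot restr_equiv U r} u1)
                (\pi_{eq_quot restr_equiv U r} u2) =
              \pi_{eq_quot restr_equiv U r} u1]].

Definition class_le (r : equiv_rel T) : {eq_quot r} -> {eq_quot r} -> Prop :=
  clos_refl_trans _ (@class_below r).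

Definition has_largest_class (r : equiv_rel T) : Prop :=
  exists c : {eq_quot r}, forall d : {eq_quot r}, class_le d c.

End Tame.

(* Main.v *)
Require Import Defs.
From Stdlib Require Import Relation_Operators.
From mathcomp Require Import all_boot generic_quotient.
From mathcomp Require Import boolp.

Set Implicit Arguments.
Unset Strict Implicit.
Unset Printing Implicit Defensive.

Local Open Scope quotient_scope.

(* Let b < t be the two classes met by some minimal set U.  Since ~ is maximal,
   any two ~-inequivalent elements are separated by a unary polynomial into U;
   type 5 says that polynomials into U restricted to {b, t} are meets or
   constants, so none of them is a join.  Order A/~ by the reflexive-transitive
   closure of the pairs (f b, f t), f a unary polynomial: polynomials are
   monotone, and the given order is contained in this one, so there is a top
   class a.  With s(x, y) = w(x, ..., x, y), the absence of joins together with
   the WNU identities forces s(a, c) ~ c, whence s(x, y) is the greatest lower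
   bound of x and y modulo ~, and so is s(x, s(x, ... s(x, y))).  By the term
   condition s(x, -) is injective on the class of x, so iterating it |A|! times
   gives the identity there. *)

(** * Closure properties of polynomial operations *)

Section Polynomials.
Variables (T : Type) (A : algebra T).

Lemma eval_ext (V : Type) (e e' : V -> T) (t : term A V) :
  e =1 e' -> eval e t = eval e' t.
Proof.
move=> ee'; elim: t => [v|s ts IH] //=.
by congr op; apply/ffunP=> i; rewrite !ffunE.
Qed.

Fixpoint subst (V W : Type) (f : V -> term A W) (t : term A V) : term A W :=
  match t with
  | Var v => f v
  | App s ts => App (fun i => subst f (ts i))
  end.

Lemma eval_subst (V W : Type) (f : V -> term A W) (e : W -> T) (t : term A V) :
  eval e (subst f t) = eval (fun v => eval e (f v)) t.
Proof.
elim: t => [v|s ts IH] //=.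
by congr op; apply/ffunP=> i; rewrite !ffunE.
Qed.

Lemma pol_ext n (f g : {ffun 'I_n -> T} -> T) :
  f =1 g -> is_pol_op A f -> is_pol_op A g.
Proof. by move=> fg [t ft]; exists t => x; rewrite -fg. Qed.

Lemma pol_proj n (i : 'I_n) : is_pol_op A (fun x : {ffun 'I_n -> T} => x i).
Proof. by exists (Var A (inl i)). Qed.

Lemma pol_const n (a : T) : is_pol_op A (fun _ : {ffun 'I_n -> T} => a).
Proof. by exists (Var A (inr a)). Qed.

Lemma pol_basic (s : symb A) : is_pol_op A (@op _ A s).
Proof.
exists (App (fun i => Var A (inl i))) => x /=.
by congr op; apply/ffunP=> i; rewrite ffunE.
Qed.

Lemma pol_comp k n (q : {ffun 'I_k -> T} -> T)
    (f : 'I_k -> {ffun 'I_n -> T} -> T) :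
  is_pol_op A q -> (forall i, is_pol_op A (f i)) ->
  is_pol_op A (fun x => q [ffun i => f i x]).
Proof.
move=> [t qt] /fin_all_exists [u fu].
exists (subst (fun v => match v with
                        | inl i => u i
                        | inr a => Var A (inr a)
                        end) t) => x.
rewrite qt eval_subst; apply: eval_ext => -[i|a] //=.
by rewrite ffunE fu.
Qed.

Definition is_pol2 (p : T -> T -> T) : Prop := is_pol_op A (binop p).

Lemma pol1_comp_op n (f : T -> T) (q : {ffun 'I_n -> T} -> T) :
  is_pol1 A f -> is_pol_op A q -> is_pol_op A (fun x => f (q x)).
Proof.
move=> pf pq; have := pol_comp pf (fun=> pq).
by apply: pol_ext => x; rewrite ffunE.
Qed.

Lemma pol1_const (a : T) : is_pol1 A (fun=> a).
Proof. exact: pol_const. Qed.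

Lemma pol1_comp (f g : T -> T) :
  is_pol1 A f -> is_pol1 A g -> is_pol1 A (fun x => f (g x)).
Proof. by move=> pf pg; exact: pol1_comp_op pf pg. Qed.

Lemma pol2_comp_op n (p : T -> T -> T) (f g : {ffun 'I_n -> T} -> T) :
  is_pol2 p -> is_pol_op A f -> is_pol_op A g ->
  is_pol_op A (fun x => p (f x) (g x)).
Proof.
move=> pp pf pg.
have := pol_comp (f := fun i : 'I_2 => if i == ord0 then f else g) pp.
move=> /(_ _)/pol_ext; apply; first by move=> x; rewrite /binop !ffunE.
by move=> i; case: eqP.
Qed.

Lemma pol1_comp2 (f : T -> T) (p : T -> T -> T) :
  is_pol1 A f -> is_pol2 p -> is_pol2 (fun x y => f (p x y)).
Proof. by move=> pf pp; exact: pol1_comp_op pf pp. Qed.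

Lemma pol2_comp1 (p : T -> T -> T) (f g : T -> T) :
  is_pol2 p -> is_pol1 A f -> is_pol1 A g -> is_pol2 (fun x y => p (f x) (g y)).
Proof.
move=> pp pf pg.
apply: (@pol2_comp_op _ _ (fun x => f (x ord0)) (fun x => g (x ord_max))) => //.
  exact: pol1_comp_op pf (pol_proj _).
exact: pol1_comp_op pg (pol_proj _).
Qed.

Lemma pol2_left (p : T -> T -> T) (b : T) : is_pol2 p -> is_pol1 A (p^~ b).
Proof. by move=> pp; apply: (pol2_comp_op pp); [exact: pol_proj|exact: pol_const]. Qed.

Lemma pol2_right (p : T -> T -> T) (a : T) : is_pol2 p -> is_pol1 A (p a).
Proof. by move=> pp; apply: (pol2_comp_op pp); [exact: pol_const|exact: pol_proj]. Qed.

Lemma pol_slice n (q : {ffun 'I_n -> T} -> T) (x : {ffun 'I_n -> T}) (i : 'I_n) :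
  is_pol_op A q -> is_pol1 A (fun a => q [ffun j => if j == i then a else x j]).
Proof.
move=> pq; pose f (j : 'I_n) (a : {ffun 'I_1 -> T}) :=
  if j == i then a ord0 else x j.
have := pol_comp (f := f) pq; apply => j; rewrite /f.
by case: eqP => _; [exact: pol_proj|exact: pol_const].
Qed.

(** The coordinates of [x] are replaced by those of [y] one at a time: [z k] has its first [k]
    coordinates from [y], and the step from [z k] to [z k.+1] is a unary polynomial in the changed
    coordinate. *)
Lemma compatible_of_unary (R : T -> T -> Prop) :
  (forall x, R x x) -> (forall x y z, R x y -> R y z -> R x z) ->
  (forall f x y, is_pol1 A f -> R x y -> R (f x) (f y)) ->
  forall n (q : {ffun 'I_n -> T} -> T) (x y : {ffun 'I_n -> T}),
    is_pol_op A q -> (forall i, R (x i) (y i)) -> R (q x) (q y).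
Proof.
move=> Rxx Rtr Rpol n q x y pq xy.
pose z k : {ffun 'I_n -> T} := [ffun j : 'I_n => if j < k then y j else x j].
suff Rz k : k <= n -> R (q x) (q (z k)).
  have -> : y = z n by apply/ffunP=> j; rewrite ffunE ltn_ord.
  exact: Rz.
elim: k => [|k IH] kn.
  suff -> : z 0 = x by [].
  by apply/ffunP=> j; rewrite ffunE.
apply: Rtr (IH (ltnW kn)) _; pose i := Ordinal kn.
have zk : z k = [ffun j => if j == i then x i else z k j].
  by apply/ffunP=> j; rewrite !ffunE; case: (j =P i) => [->|//]; rewrite ltnn.
have -> : z k.+1 = [ffun j => if j == i then y i else z k j].
  apply/ffunP=> j; rewrite !ffunE ltnS leq_eqVlt.
  rewrite -(inj_eq val_inj) /=; case: (val j =P k) => [jk|//].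
  by congr (y _); apply: val_inj.
rewrite {1}zk.
exact: (Rpol (fun a => q [ffun j => if j == i then a else z k j])) (pol_slice _ _ pq) _.
Qed.

End Polynomials.

Lemma pol_congruence (T : choiceType) (A : algebra T) (r : equiv_rel T) n
    (q : {ffun 'I_n -> T} -> T) (x y : {ffun 'I_n -> T}) :
  is_congruence A r -> is_pol_op A q -> (forall i, r (x i) (y i)) ->
  r (q x) (q y).
Proof.
move=> cr [t qt] xy; rewrite !qt; elim: t {qt} => [[i|a]|s ts IH] //=.
by apply: cr => i; rewrite !ffunE.
Qed.

Lemma pol1_congruence (T : choiceType) (A : algebra T) (r : equiv_rel T)
    (f : T -> T) (x y : T) :
  is_congruence A r -> is_pol1 A f -> r x y -> r (f x) (f y).
Proof.
move=> cr pf xy.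
by have := pol_congruence (x := [ffun=> x]) (y := [ffun=> y]) cr pf;
  rewrite !ffunE; apply => i; rewrite !ffunE.
Qed.

Lemma pol2_congruence (T : choiceType) (A : algebra T) (r : equiv_rel T)
    (p : T -> T -> T) (x x' y y' : T) :
  is_congruence A r -> is_pol2 A p -> r x x' -> r y y' -> r (p x y) (p x' y').
Proof.
move=> cr pp xx' yy'; apply: (equiv_trans (y := p x' y)).
  exact: pol1_congruence cr (pol2_left y pp) xx'.
exact: pol1_congruence cr (pol2_right x' pp) yy'.
Qed.

(** * Separation of inequivalent elements by unary polynomials *)

Section Separation.
Variables (T : choiceType) (A : algebra T) (r : equiv_rel T) (U : {pred T}).

(** The pairs that no unary polynomial into [U] separates form a congruence above [r]. The given [f]
    makes it proper, so maximality identifies it with [r]. *)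
Lemma maximal_separation :
  is_maximal_congruence A r ->
  (exists2 f, is_pol1 A f /\ (forall x, f x \in U)
            & exists x y, ~~ r (f x) (f y)) ->
  forall x y, ~~ r x y ->
    exists g, [/\ is_pol1 A g, forall z, g z \in U & ~~ r (g x) (g y)].
Proof.
move=> [cr _ maxr] [f [pf fU] [u [v nuv]]] x y nxy.
pose R x y := forall g, is_pol1 A g -> (forall z, g z \in U) -> r (g x) (g y).
have Req : equiv_class_of (fun x y => `[< R x y >]).
  split=> [a|a b|b a c].
  - by apply/asboolP => g _ _; exact: equiv_refl.
  - by apply/asboolP/asboolP => h g pg gU; rewrite equiv_sym; exact: h.
  - move=> /asboolP ab /asboolP bc; apply/asboolP => g pg gU.
    exact: equiv_trans (ab g pg gU) (bc g pg gU).
apply: contrapT => nsep; case/negP: nxy.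
have <- : EquivRelPack Req x y = r x y.
  apply: maxr.
  - move=> s a b ab; apply/asboolP; rewrite -/(R _ _).
    apply: (compatible_of_unary (A := A)) (pol_basic s) _.
    + by move=> c g _ _; exact: equiv_refl.
    + by move=> c d e cd de g pg gU; exact: equiv_trans (cd g pg gU) (de g pg gU).
    + by move=> h c d ph cd g pg gU; exact: (cd (fun z => g (h z)) (pol1_comp pg ph)).
    + by move=> i; apply/asboolP/ab.
  - by move=> a b ab; apply/asboolP => g pg _; exact: pol1_congruence cr pg ab.
  - by move=> /(_ u v)/asboolP/(_ f pf fU); rewrite (negPf nuv).
apply/asboolP => g pg gU; apply: contrapT => /negP ng.
by apply: nsep; exists g.
Qed.

End Separation.

(** * Consequences of inducing a two-element semilattice on a set *)

Section InducedSemilattice.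

(** Induction on the term: constants use idempotence, and applications use the medial law [mACA],
    which holds in every commutative semigroup. *)
Lemma semilattice_pol_morph (Q : Type) (m : Q -> Q -> Q) n
    (F : {ffun 'I_n -> Q} -> Q) (x y : {ffun 'I_n -> Q}) :
  is_semilattice m -> is_pol_op (alg1 (binop m)) F ->
  F [ffun i => m (x i) (y i)] = m (F x) (F y).
Proof.
move=> [mA mC mm] [t Ft]; rewrite !Ft; elim: t {Ft} => [[i|a]|s ts IH] //=.
- by rewrite ffunE.
- have mACA a b c d : m (m a b) (m c d) = m (m a c) (m b d).
    by rewrite -!mA (mA b) (mC b c) -mA.
  by rewrite /binop !ffunE !IH mACA.
Qed.

Variables (T : finType) (A : algebra T) (r : equiv_rel T).

(* The restriction of q to {b, t} is, modulo r, a constant or a meet of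
   variables, for b the bottom and t the top. *)
Definition meet_range (U : {set T}) (b t : T) : Prop :=
  forall n (q : {ffun 'I_n -> T} -> T),
    is_pol_op A q -> (forall x, q x \in U) -> forall c d : pred 'I_n,
    r (q [ffun i => if c i && d i then t else b]) t =
    r (q [ffun i => if c i then t else b]) t &&
    r (q [ffun i => if d i then t else b]) t.

Definition meet_pol (b t : T) (p : T -> T -> T) : Prop :=
  [/\ is_pol2 A p, r (p b b) b, r (p b t) b, r (p t b) b & r (p t t) t].

Variables (U : {set T}) (m : {eq_quot restr_equiv U r} ->
   {eq_quot restr_equiv U r} -> {eq_quot restr_equiv U r}).
Hypotheses (cr : is_congruence A r) (mU : induces_semilattice A m).
Variables u1 u2 : {x : T | x \in U}.
Hypothesis nu12 : ~~ r (val u1) (val u2).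
Hypothesis mu12 : m (\pi_{eq_quot restr_equiv U r} u1)
                (\pi_{eq_quot restr_equiv U r} u2) =
              \pi_{eq_quot restr_equiv U r} u1.

Let Q := {eq_quot restr_equiv U r}.
Let pi (u : {x : T | x \in U}) : Q := \pi_{eq_quot restr_equiv U r} u.

Let piE u v : (pi u = pi v) <-> r (val u) (val v).
Proof. by split=> [/eqmodP|h]; last apply/eqmodP. Qed.

Let repr_pi u : r (val (repr (pi u))) (val u).
Proof. by apply/piE; rewrite /pi reprK. Qed.

Let Q2 (c : Q) : c = pi u1 \/ c = pi u2.
Proof.
have [[a [b [_ ab]]] _ _] := mU.
have n12 : pi u1 <> pi u2 by move/piE; apply/negP.
by case: (ab (pi u1)) (ab (pi u2)) (ab c) n12 => [->|->] [->|->] [->|->]; auto.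
Qed.

Lemma induced_range x : x \in U -> r x (val u1) \/ r x (val u2).
Proof.
by move=> xU; case: (Q2 (pi (exist _ x xU))) => /piE; [left|right].
Qed.

Let u (c : bool) := if c then u2 else u1.

Let mu c d : m (pi (u c)) (pi (u d)) = pi (u (c && d)).
Proof.
have [_ [_ mC mm] _] := mU.
by case: c d => [] [] //=; rewrite ?mm // mC.
Qed.

(** A polynomial with values in [U] is a basic operation of the induced algebra, so its quotient is
    a polynomial of the semilattice and commutes with [m]. This is then read off on tuples over [u1]
    and [u2]. *)
Lemma induced_meet_range : meet_range U (val u1) (val u2).
Proof.
move=> n q pq qU c d.
have [_ sm pm] := mU.
pose s := @InducedSymb T A U n q pq (fun x _ => qU x).
pose F (x : {ffun 'I_n -> Q}) : Q :=
  op (a := quot_alg (induced_alg A U) (restr_equiv U r)) (s := s) x.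
have /pm pF : is_pol_op (quot_alg (induced_alg A U) (restr_equiv U r)) F.
  exact: (pol_basic (A := quot_alg (induced_alg A U) (restr_equiv U r)) s).
pose v (a : pred 'I_n) :=
  exist (fun y => y \in U) _ (qU [ffun i => if a i then val u2 else val u1]).
(* Quotient operations are computed at chosen representatives; compatibility with [r] lets these be
   replaced by [u1] and [u2]. *)
have FE (a : pred 'I_n) : F [ffun i => pi (u (a i))] = pi (v a).
  apply/piE => /=; apply: (pol_congruence cr pq) => i; rewrite !ffunE.
  apply: equiv_trans (repr_pi _) _; rewrite /u; case: (a i); exact: equiv_refl.
have := semilattice_pol_morph [ffun i => pi (u (c i))] [ffun i => pi (u (d i))] sm pF.
have -> : [ffun i => m ([ffun i => pi (u (c i))] i) ([ffun i => pi (u (d i))] i)]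
   = [ffun i => pi (u (c i && d i))] :> {ffun 'I_n -> Q}.
  by apply/ffunP=> i; rewrite !ffunE mu.
rewrite (FE (fun i => c i && d i)) !FE.
move=> vm; have tE y : r (val y) (val u2) = `[< pi y = pi u2 >].
  by apply/idP/asboolP => /piE.
rewrite -[LHS]/(r (val (v (fun i => c i && d i))) _).
rewrite -[RHS]/(r (val (v c)) _ && r (val (v d)) _) !tE vm.
have n12 : (`[< pi u1 = pi u2 >] = false) by rewrite -tE (negPf nu12).
have t22 : (`[< pi u2 = pi u2 >] = true) by apply/asboolP.
by case: (Q2 (pi (v c))) (Q2 (pi (v d))) => [->|->] [->|->];
  rewrite ?(mu true true) ?(mu true false) ?(mu false true) ?(mu false false)
    /= ?n12 ?t22.
Qed.

(** Induction on the term of [F]: each constant class is replaced by its representative, each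
    induced operation by the polynomial of [A] that it restricts. *)
Lemma lift_quot_pol n (F : {ffun 'I_n -> Q} -> Q) :
  is_pol_op (quot_alg (induced_alg A U) (restr_equiv U r)) F ->
  exists2 q, is_pol_op A q & forall x : {ffun 'I_n -> {x : T | x \in U}},
    r (q [ffun i => val (x i)]) (val (repr (F [ffun i => pi (x i)]))).
Proof.
move=> [t Ft].
suff [q pq qt] : exists2 q, is_pol_op A q &
   forall x : {ffun 'I_n -> {x : T | x \in U}},
    r (q [ffun i => val (x i)]) (val (repr (eval (fun v => match v with
      inl i => [ffun i => pi (x i)] i | inr a => a end) t))).
  by exists q => // x; rewrite Ft; exact: qt.
elim: t {F Ft} => [[i|a]|s ts IH].
- exists (fun x => x i); first exact: pol_proj.
  by move=> x; rewrite /= !ffunE equiv_sym; exact: repr_pi.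
- by exists (fun=> val (repr a)); [exact: pol_const|move=> x; exact: equiv_refl].
have {}IH (i : 'I_(ind_arity s)) : exists f : {ffun 'I_n -> T} -> T,
  is_pol_op A f /\ forall x : {ffun 'I_n -> {x : T | x \in U}},
    r (f [ffun i => val (x i)]) (val (repr (eval (fun v => match v with
      inl i => [ffun i => pi (x i)] i | inr a => a end) (ts i)))).
  by have [q pq qt] := IH i; exists q.
have [f pf] := fin_all_exists IH.
exists (fun x => @ind_fun _ _ _ s [ffun i => f i x]).
  by apply: pol_comp (@ind_pol _ _ _ s) _ => i; case: (pf i).
move=> x /=; rewrite equiv_sym; apply: equiv_trans (repr_pi _) _ => /=.
rewrite equiv_sym; apply: pol_congruence cr (@ind_pol _ _ _ s) _ => i.
by rewrite !ffunE; exact: (pf i).2.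
Qed.

(** The converse half of polynomial equivalence: [m] is a polynomial of the quotient, hence lifts to
    a polynomial of [A]. *)
Lemma induced_meet_pol : exists p, meet_pol (val u1) (val u2) p.
Proof.
have [_ sm pm] := mU.
have /pm/lift_quot_pol[q pq qm] : is_pol_op (alg1 (binop m)) (binop m).
  exact: (pol_basic (A := alg1 (binop m)) tt).
pose p x y := q [ffun i => if i == ord0 then x else y].
have pE c d : r (p (val (u c)) (val (u d))) (val (u (c && d))).
  have := qm [ffun i => if i == ord0 then u c else u d].
  rewrite /binop !ffunE /= mu => h.
  have -> : p (val (u c)) (val (u d)) =
     q [ffun i => val ([ffun i : 'I_2 => if i == ord0 then u c else u d] i)].
    by congr q; apply/ffunP=> i; rewrite !ffunE; case: eqP.
  exact: equiv_trans h (repr_pi _).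
exists p; split; last exact: (pE true true); first last.
- exact: (pE true false).
- exact: (pE false true).
- exact: (pE false false).
apply: pol_ext pq => x; rewrite /binop /p; congr q; apply/ffunP=> i.
rewrite ffunE; case: eqP => [->//|/eqP i0]; congr (x _).
by apply: val_inj; case: i i0 => -[|[|]].
Qed.

End InducedSemilattice.

Lemma equiv_left (T : choiceType) (r : equiv_rel T) x y z : r x y -> r x z = r y z.
Proof.
move=> xy; apply/idP/idP => h; last exact: equiv_trans xy h.
by apply: equiv_trans _ h; rewrite equiv_sym.
Qed.

Lemma equiv_joinr (T : choiceType) (r : equiv_rel T) x y z :
  r x z -> r y z -> r x y.
Proof. by move=> xz yz; apply: equiv_trans xz _; rewrite equiv_sym. Qed.

(** * The order generated by polynomial images of the pair [b], [t] *)

Section PolynomialOrder.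
Variables (T : finType) (A : algebra T) (r : equiv_rel T).
Variables (U : {set T}) (b t : T).

Definition separates_into : Prop :=
  forall x y, ~~ r x y ->
    exists g, [/\ is_pol1 A g, forall z, g z \in U & ~~ r (g x) (g y)].

Definition pol_edge (x y : T) : Prop :=
  exists f, [/\ is_pol1 A f, r (f b) x & r (f t) y].

(** Chains grow at their lower end, so that induction exposes the first edge. *)
Definition pol_le : T -> T -> Prop := clos_refl_trans_1n T pol_edge.

Hypotheses (cr : is_congruence A r) (sepU : separates_into).
Hypotheses (rangeU : forall x, x \in U -> r x b \/ r x t).
Hypothesis meetU : meet_range A r U b t.

Lemma pol_edge_eqv x y : r x y -> pol_edge x y.
Proof.
by move=> xy; exists (fun=> x); split=> //; exact: pol1_const.
Qed.

Lemma pol_edge_le x y : pol_edge x y -> pol_le x y.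
Proof. by move=> xy; apply: rt1n_trans xy _; exact: rt1n_refl. Qed.

Lemma pol_le_eqv x y : r x y -> pol_le x y.
Proof. by move=> /pol_edge_eqv; exact: pol_edge_le. Qed.

Lemma pol_le_refl x : pol_le x x.
Proof. exact: rt1n_refl. Qed.

Lemma pol_le_trans x y z : pol_le x y -> pol_le y z -> pol_le x z.
Proof.
move=> xy yz; elim: xy yz => // {}x y' z' xy' _ IH /IH.
exact: rt1n_trans.
Qed.

Lemma pol1_le f x y : is_pol1 A f -> pol_le x y -> pol_le (f x) (f y).
Proof.
move=> pf; elim=> [z|{}x z z' [h [ph hb ht]] _ IH]; first exact: pol_le_refl.
apply: rt1n_trans IH; exists (fun a => f (h a)).
by split; [exact: pol1_comp|exact: pol1_congruence pf hb|exact: pol1_congruence pf ht].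
Qed.

Lemma pol_op_le n (q : {ffun 'I_n -> T} -> T) (x y : {ffun 'I_n -> T}) :
  is_pol_op A q -> (forall i, pol_le (x i) (y i)) -> pol_le (q x) (q y).
Proof.
by apply: (compatible_of_unary (A := A));
  [exact: pol_le_refl|exact: pol_le_trans|move=> *; exact: pol1_le].
Qed.

(* A polynomial exchanging b and t modulo r would violate meet_range. *)
Lemma top_up g x y :
  is_pol1 A g -> (forall z, g z \in U) -> pol_le x y -> r (g x) t -> r (g y) t.
Proof.
move=> pg gU; elim=> [//|{}x z z' [f [pf fb ft]] _ IH gxt]; apply: IH.
have pgf := pol1_comp pg pf.
have := meetU pgf (fun x => gU (f (x ord0))) predT pred0; rewrite !ffunE /=.
have gE u v : r (f u) v -> r (g (f u)) t = r (g v) t.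
  by move=> uv; apply: equiv_left; exact: pol1_congruence pg uv.
by rewrite (gE _ _ fb) (gE _ _ ft) gxt => /esym/andP[].
Qed.

(** Composing [P] with the polynomials of the two edges moves the question to [{b, t}]. There
    [meetU], for the disjoint predicates selecting the first and the second variable, turns value
    [t] at [(t, b)] and [(b, t)] into value [t] at [(b, b)]. *)
Lemma no_join_edges P x0 x1 z0 z1 :
  is_pol2 A P -> (forall x z, P x z \in U) -> pol_edge x0 x1 -> pol_edge z0 z1 ->
  r (P x0 z1) t -> r (P x1 z0) t -> r (P x0 z0) t.
Proof.
move=> pP PU [f [pf fb ft]] [h [ph hb ht]] P01 P10.
have pQ := pol2_comp1 pP pf ph.
have PE u v x z : r (f u) x -> r (h v) z -> r (P (f u) (h v)) t = r (P x z) t.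
  by move=> ux vz; apply: equiv_left; exact: pol2_congruence pP ux vz.
have := meetU pQ (fun x => PU _ _) (pred1 ord0) (pred1 ord_max).
by rewrite /binop !ffunE /= (PE _ _ _ _ fb hb) (PE _ _ _ _ fb ht)
  (PE _ _ _ _ ft hb) P01 P10.
Qed.

Lemma no_join P x0 x1 z0 z1 :
  is_pol2 A P -> (forall x z, P x z \in U) -> pol_le x0 x1 -> pol_le z0 z1 ->
  r (P x0 z1) t -> r (P x1 z0) t -> r (P x0 z0) t.
Proof.
move=> pP PU lx lz.
(* First a chain in [x] against a single edge in [z]; [top_up] carries the value [t] along the chain
   so that the induction hypothesis applies. *)
have edge_z z z' : pol_edge z z' ->
    r (P x0 z') t -> r (P x1 z) t -> r (P x0 z) t.
  move=> ez; elim: lx => [//|x x' x'' ex _ IH P01 P10].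
  apply: (no_join_edges pP PU ex ez) => //; apply: IH => //.
  exact: (top_up (pol2_left z' pP) (fun x => PU x z') (pol_edge_le ex)).
elim: lz => [//|z z' z'' ez _ IH P01 P10].
apply: (edge_z _ _ ez) => //; apply: IH => //.
exact: (top_up (pol2_right x1 pP) (PU x1) (pol_edge_le ez)).
Qed.

(** By [top_up] in both directions, a polynomial into [U] is [t] at [x] exactly when it is [t] at
    [y], so none separates the two. *)
Lemma pol_le_antisym x y : pol_le x y -> pol_le y x -> r x y.
Proof.
move=> xy yx; apply: contrapT => /negP/sepU[g [pg gU /negP]]; apply.
have yt := top_up pg gU xy; have xt := top_up pg gU yx.
case: (rangeU (gU x)) => [gx|/[dup] gx /yt gy]; last exact: equiv_joinr gx gy.
case: (rangeU (gU y)) => [gy|/[dup] gy /xt {}gx]; exact: equiv_joinr gx gy.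
Qed.

(** This puts the order generated by all minimal sets inside [pol_le] for one fixed pair: [h] itself
    witnesses the edge unless it reverses the pair, and a reversal produces a forbidden polynomial
    on [V]. *)
Lemma pol_edge_of_meet (V : {set T}) (u1 u2 : T) (p : T -> T -> T) (h : T -> T) :
  meet_pol A r b t p ->
  (forall x, x \in V -> r x u1 \/ r x u2) -> ~~ r u1 u2 ->
  meet_range A r V u1 u2 ->
  is_pol1 A h -> (forall z, h z \in V) -> ~~ r (h b) (h t) ->
  pol_edge u1 u2.
Proof.
move=> [pp pbb pbt ptb ptt] rangeV n12 meetV ph hV nh.
case: (rangeV _ (hV b)) (rangeV _ (hV t)) => hb [] ht.
- by rewrite (equiv_joinr hb ht) in nh.
- by exists h.
- have [g [pg gU ng]] := sepU n12.
  have hE u v : r u v -> r (h u) u2 = r (h v) u2.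
    by move=> uv; apply: equiv_left; exact: pol1_congruence ph uv.
  have h1 : r (h t) u2 = false by rewrite (equiv_left _ ht) (negPf n12).
  case: (rangeU (gU u1)) (rangeU (gU u2)) => gu1 [] gu2.
  + by rewrite (equiv_joinr gu1 gu2) in ng.
  (* If [g] preserves the orientation, [h] after [g] exchanges [u1] and [u2]. *)
  + have := meetV _ _ (pol1_comp ph pg) (fun x => hV _) predT pred0.
    by rewrite !ffunE /= (hE _ _ gu1) (hE _ _ gu2) hb h1.
  (* If [g] reverses it as well, [h (p (g x) (g y))] is the meet conjugated by two reversals, that
     is, a join on [u1], [u2]. *)
  + have pq := pol1_comp2 ph (pol2_comp1 pp pg pg).
    have := meetV _ _ pq (fun x => hV _) (pred1 ord0) (pred1 ord_max).
    have pE u v u' v' c : r (g u) u' -> r (g v) v' -> r (p u' v') c ->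
        r (h (p (g u) (g v))) u2 = r (h c) u2.
      move=> uu vv uvc; apply: hE; apply: equiv_trans _ uvc.
      exact: pol2_congruence pp uu vv.
    rewrite /binop !ffunE /= (pE _ _ _ _ _ gu1 gu1 ptt) (pE _ _ _ _ _ gu1 gu2 ptb).
    by rewrite (pE _ _ _ _ _ gu2 gu1 pbt) hb h1.
  + by rewrite (equiv_joinr gu1 gu2) in ng.
- by rewrite (equiv_joinr hb ht) in nh.
Qed.

(** Greatest lower bounds are unique modulo [r] by antisymmetry, and [pol_le] absorbs the
    representatives inside [quot_binop]. *)
Lemma meet_quot_semilattice (M : T -> T -> T) :
  (forall x y, pol_le (M x y) x) -> (forall x y, pol_le (M x y) y) ->
  (forall x y z, pol_le z x -> pol_le z y -> pol_le z (M x y)) ->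
  is_semilattice (quot_binop (r := r) M).
Proof.
move=> Ml Mr Mg.
have ML x y z : pol_le x z -> pol_le (M x y) z by apply: pol_le_trans.
have MR x y z : pol_le y z -> pol_le (M x y) z by apply: pol_le_trans.
have rpi x : r (repr (\pi_{eq_quot r} x)) x.
  by apply/eqmodP; rewrite reprK.
have le_rpi x z : pol_le z x -> pol_le z (repr (\pi_{eq_quot r} x)).
  by move=> zx; apply: pol_le_trans zx (pol_le_eqv _); rewrite equiv_sym.
have rpi_le x z : pol_le x z -> pol_le (repr (\pi_{eq_quot r} x)) z.
  exact: pol_le_trans (pol_le_eqv (rpi x)).
split=> [c d e|c d|c]; rewrite /quot_binop.
- apply/eqmodP; apply: pol_le_antisym.
  + apply: (Mg); last by apply: (MR); apply: (rpi_le).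
    apply: (le_rpi); apply: (Mg); first exact: Ml.
    by apply: (MR); apply: (rpi_le).
  + apply: (Mg); first by apply: (ML); apply: (rpi_le).
    apply: (le_rpi); apply: (Mg); last exact: Mr.
    by apply: (ML); apply: (rpi_le).
- by apply/eqmodP; apply: pol_le_antisym; apply: (Mg).
- rewrite -[RHS]reprK; apply/eqmodP; apply: pol_le_antisym => //.
  by apply: (Mg); exact: pol_le_refl.
Qed.

End PolynomialOrder.

(** * The term condition for binary polynomials *)

Section Abelian.
Variables (T : choiceType) (A : algebra T) (r : equiv_rel T).
Hypothesis ab_r : is_abelian_congruence A r.

Lemma abelian_pol2 (p : T -> T -> T) u v x y :
  is_pol2 A p -> r u v -> r x y -> p u x = p u y -> p v x = p v y.
Proof.
move=> pp uv xy pE; have [_ /(_ 1 _ pp u v [ffun=> x] [ffun=> y] uv)] := ab_r.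
have pcons a b : binop p (fcons a [ffun=> b : T]) = p a b.
  rewrite /binop /fcons !ffunE unlift_none.
  have -> : ord_max = lift ord0 ord0 :> 'I_2 by apply: val_inj.
  by rewrite liftK ffunE.
rewrite !pcons => h; apply/eqP/h; last exact/eqP.
by move=> i; rewrite !ffunE.
Qed.

End Abelian.

(** * The binary operation derived from a weak near-unanimity operation *)

Section Wnu.
Variables (T : finType) (n : nat) (w : {ffun 'I_n -> T} -> T).
Hypothesis wnu_w : is_wnu w.
Variable i0 : 'I_n.

Let A := alg1 w.

Definition wnu2 (x y : T) : T := w [ffun k => if k == i0 then y else x].

Lemma wnu2E i x y : w [ffun k => if k == i then y else x] = wnu2 x y.
Proof. by case: wnu_w => _; exact. Qed.

Lemma wnu_idem x : w [ffun=> x] = x.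
Proof. by case: wnu_w. Qed.

Lemma wnu2_idem x : wnu2 x x = x.
Proof.
by rewrite -[RHS]wnu_idem /wnu2; congr w; apply/ffunP => k; rewrite !ffunE if_same.
Qed.

Lemma pol_w : is_pol_op A w.
Proof. exact: (pol_basic (A := alg1 w) tt). Qed.

Lemma pol2_wnu2 : is_pol2 A wnu2.
Proof.
apply: (pol_comp (f := fun k x => if k == i0 then x ord_max else x ord0) pol_w) => k.
by case: eqP => _; exact: pol_proj.
Qed.

Lemma term_op_iter_wnu2 k :
  is_term_op A (binop (fun x y => iter k (wnu2 x) y)).
Proof.
elim: k => [|k [t tE]]; first by exists (Var _ ord_max).
exists (App (A := A) (s := tt)
  (fun j : 'I_n => if j == i0 then t else Var _ ord0)) => x.
rewrite /binop /= /wnu2; congr w; apply/ffunP => j; rewrite !ffunE.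
by case: eqP => // _; rewrite -tE.
Qed.

(** * The derived operation as a meet modulo [r] *)

Section WnuOrder.
Variables (r : equiv_rel T) (U : {set T}) (b t : T).
Hypotheses (cr : is_congruence A r) (sepU : separates_into A r U).
Hypotheses (rangeU : forall x, x \in U -> r x b \/ r x t).
Hypothesis meetU : meet_range A r U b t.

(** By the WNU identities [q] is [t] at every tuple with exactly one [b]. Intersecting these tuples
    one position at a time, [meetU] keeps the value [t] down to the constant tuple [b], where
    idempotence gives [g (f b)]. *)
Lemma wnu2_full (f g : T -> T) :
  is_pol1 A f -> is_pol1 A g -> (forall z, g z \in U) ->
  r (g (wnu2 (f t) (f b))) t -> r (g (f b)) t.
Proof.
move=> pf pg gU gt.
pose q x := g (w [ffun i => f (x i)]).
have pq : is_pol_op A q.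
  apply: pol1_comp_op pg _; apply: pol_comp pol_w _ => i.
  exact: pol1_comp_op pf (pol_proj _ _).
have qm := meetU pq (fun x => gU _).
have qk (k : 'I_n) : r (q [ffun i => if predC1 k i then t else b]) t.
  move: gt; rewrite -(wnu2E k) /q.
  by congr (r (g (w _)) t); apply/ffunP=> i; rewrite !ffunE /=; case: eqP.
have qle k : k <= n -> r (q [ffun i : 'I_n => if k <= i then t else b]) t.
  elim: k => [|k IH] kn.
    (* The constant tuple [t] lies above the tuple with [b] only at [i0], so [meetU] gives the value
       [t] there too. *)
    have := qm predT (predC1 i0); rewrite /= in qk *; rewrite qk.
    by move=> /esym/andP[].
  have qE := qm (fun i : 'I_n => k <= i) (predC1 (Ordinal kn)).
  suff <- : [ffun i : 'I_n => if (k <= i) && predC1 (Ordinal kn) i then t else b] =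
            [ffun i : 'I_n => if k < i then t else b].
    by rewrite qE IH ?(ltnW kn) // qk.
  by apply/ffunP=> i; rewrite !ffunE /= ltn_neqAle -val_eqE /= eq_sym andbC.
move: (qle n (leqnn n)); rewrite /q -[f b]wnu_idem; congr (r (g (w _)) t).
by apply/ffunP=> i; rewrite !ffunE leqNgt ltn_ord.
Qed.

(** Edges that stay inside the class of [x] are skipped until one leaves it. *)
Lemma pol_le_first_step x y : pol_le A r b t x y -> ~~ r x y ->
  exists f, [/\ is_pol1 A f, r (f b) x, ~~ r (f b) (f t) & pol_le A r b t (f t) y].
Proof.
elim=> [z|{}x z z' [f [pf fb ft]] lz IH nxz'].
  by rewrite equiv_refl.
case ff: (r (f b) (f t)); last first.
  exists f; rewrite ff; split=> //.
  exact: pol_le_trans (pol_le_eqv A b t ft) lz.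
have xz : r x z by rewrite -(equiv_left _ fb) (equiv_left _ ff).
have [|h [ph hb hh hle]] := IH; first by rewrite -(equiv_left _ xz).
by exists h; split=> //; exact: equiv_joinr hb xz.
Qed.

Variable a : T.
Hypothesis atop : forall x, pol_le A r b t x a.

Lemma wnu2_le x x' y y' : pol_le A r b t x x' -> pol_le A r b t y y' ->
  pol_le A r b t (wnu2 x y) (wnu2 x' y').
Proof.
move=> xx' yy'; apply: (pol_op_le cr pol_w) => i.
by rewrite !ffunE; case: eqP.
Qed.

(* If c < s(a, c) with s = wnu2, then some polynomial g into U takes values
   b at c and t at d, for a first step c < d below s(a, c).  Then g(s(z, x))
   is t at (x, z) = (c, a) and (d, d), hence at (c, d) as there is no join;
   but by the WNU identities g(s(d, c)) is b. *)
Lemma wnu2_top c : r (wnu2 a c) c.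
Proof.
rewrite equiv_sym; apply: contrapT => /negP nc.
have lc : pol_le A r b t c (wnu2 a c).
  by rewrite -{1}[c]wnu2_idem; apply: wnu2_le => //; exact: pol_le_refl.
have [f [pf fb ff lf]] := pol_le_first_step lc nc.
have [g [pg gU gf]] := sepU ff.
have lff : pol_le A r b t (f b) (f t).
  by apply: pol_edge_le; exists f; split.
have ngb : ~~ r (g (f b)) t.
  apply/negP => gb; case/negP: gf; apply: (equiv_joinr gb).
  exact: (top_up cr meetU pg gU lff gb).
have gt : r (g (f t)) t.
  case: (rangeU (gU (f t))) => // gt; case: (rangeU (gU (f b))) => gb.
    by rewrite (equiv_joinr gb gt) in gf.
  by rewrite gb in ngb.
case/negP: ngb; apply: (wnu2_full pf pg gU).
have pP : is_pol2 A (fun x z => g (wnu2 z x)).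
  apply: pol1_comp_op pg _.
  by apply: pol2_comp_op pol2_wnu2 _ _; exact: pol_proj.
apply: (no_join cr meetU pP (fun x z => gU _) lff (atop (f t))); last first.
  by rewrite wnu2_idem.
have := top_up cr meetU pg gU lf gt.
rewrite (equiv_left _ (_ : r _ (g (wnu2 a (f b))))) //.
apply: pol1_congruence cr pg _; apply: pol1_congruence cr (pol2_right _ pol2_wnu2) _.
by rewrite equiv_sym.
Qed.

Lemma wnu2_leR x y : pol_le A r b t (wnu2 x y) y.
Proof.
apply: pol_le_trans (pol_le_eqv A b t (wnu2_top y)).
by apply: wnu2_le; [exact: atop|exact: pol_le_refl].
Qed.

(** Every argument except the [x] at position [i1] is raised to the top [a]; the WNU identities make
    the result [wnu2 a x]. A position other than [i0] guarantees that an [x] is there to keep. *)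
Lemma wnu2_leL i1 x y : i1 != i0 -> pol_le A r b t (wnu2 x y) x.
Proof.
move=> i10; apply: pol_le_trans (pol_le_eqv A b t (wnu2_top x)).
rewrite -(wnu2E i1 a x); apply: (pol_op_le cr pol_w) => i; rewrite !ffunE.
case: (i =P i0) => [->|_]; first by rewrite eq_sym (negPf i10); exact: atop.
by case: eqP => _; [exact: pol_le_refl|exact: atop].
Qed.

(** Iterates are still greatest lower bounds: the outermost application lies below [x], each
    application only descends from [y], and a lower bound [z] survives since [wnu2 z z = z]. *)
Lemma iter_wnu2_semilattice i1 k : i1 != i0 -> 0 < k ->
  is_semilattice (quot_binop (r := r) (fun x y => iter k (wnu2 x) y)).
Proof.
move=> i10; case: k => // k _.
apply: (meet_quot_semilattice cr sepU rangeU meetU) => [x y|x y|x y z zx zy].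
- exact: wnu2_leL i10.
- elim: k.+1 => [|j IH]; first exact: pol_le_refl.
  exact: pol_le_trans (wnu2_leR _ _) IH.
- elim: k.+1 => [//|j IH] /=.
  by rewrite -[z]wnu2_idem; exact: wnu2_le.
Qed.

End WnuOrder.

(** * Iterating to the second projection on each class *)

Section WnuAbelian.
Variable r : equiv_rel T.
Hypothesis ab_r : is_abelian_congruence A r.

Lemma wnu2_inj x y y' : r x y -> r x y' -> wnu2 x y = wnu2 x y' -> y = y'.
Proof.
move=> xy xy' sE.
have yy' : r y y' by rewrite -(equiv_left _ xy).
(* The term condition replaces the common first argument [x] by [y], giving
   [wnu2 y y = wnu2 y y']. *)
have {}sE := abelian_pol2 ab_r pol2_wnu2 xy yy' sE.
(* The tuple passes from constant [y] to constant [y']; if [w] never changes along the way,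
   idempotence at both ends yields [y = y']. *)
pose z k := w [ffun i : 'I_n => if i < k then y' else y].
suff zy k : k <= n -> z k = y.
  rewrite -(zy n (leqnn n)) -[RHS]wnu_idem; congr w.
  by apply/ffunP=> i; rewrite !ffunE ltn_ord.
elim: k => [|k IH] kn.
  by rewrite -[RHS]wnu_idem; congr w; apply/ffunP=> i; rewrite !ffunE.
(* Here [p y y = p y y'] is the equality [sE]; moving the first argument to [y'] by the term
   condition gives [z k = z k.+1]. *)
pose p u v := w [ffun i : 'I_n => if i < k then u else if val i == k then v else y].
have pp : is_pol2 A p.
  apply: (pol_comp (f := fun i x => if i < k then x ord0 else
    if val i == k then x ord_max else y) pol_w) => i.
  case: (i < k); first exact: pol_proj.
  by case: (val i == k); [exact: pol_proj|exact: pol_const].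
have pyE v : p y v = wnu2 y v.
  rewrite -(wnu2E (Ordinal kn)); congr w; apply/ffunP=> i; rewrite !ffunE -val_eqE /=.
  by case: ltngtP.
have := abelian_pol2 ab_r pp yy' yy'; rewrite !pyE => /(_ sE) pE.
rewrite -[RHS](IH (ltnW kn)); transitivity (p y' y'); last rewrite -pE.
  by congr w; apply/ffunP=> i; rewrite !ffunE ltnS; case: ltngtP.
by congr w; apply/ffunP=> i; rewrite !ffunE if_same.
Qed.

Lemma iter_wnu2_id x y : r x y -> iter #|T|`! (wnu2 x) y = y.
Proof.
have [cr _] := ab_r.
have rw z : r x z -> r x (wnu2 x z).
  by move=> xz; rewrite -{1}[x]wnu2_idem;
     exact: pol1_congruence cr (pol2_right _ pol2_wnu2) xz.
(* Extension by the identity off the class of [x] gives an injection of the whole finite set, so [y]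
   lies on a cycle, of length at most [#|T|]. *)
pose f z := if r x z then wnu2 x z else z.
have finj : injective f.
  rewrite /f => u v; case: ifP => xu; case: ifP => xv.
  - exact: wnu2_inj.
  - by move=> uv; rewrite -uv rw in xv.
  - by move=> uv; rewrite uv rw in xu.
  - by [].
have fiter k : r x y -> iter k f y = iter k (wnu2 x) y /\ r x (iter k (wnu2 x) y).
  move=> xy; elim: k => //= k [-> rk].
  by split; [rewrite /f rk|exact: rw].
move=> xy; have [<- _] := fiter #|T|`! xy.
have /dvdnP[j ->] : order f y %| #|T|`!.
  by apply: dvdn_fact; rewrite order_gt0 max_card.
by elim: j => // j IH; rewrite mulSn iterD IH iter_order.
Qed.

End WnuAbelian.

End Wnu.

(** A nullary idempotent [w] forces a one-element universe. A unary one is the identity, so binary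
    polynomials are projections or constants and none acts as a meet on [b], [t]. *)
Lemma wnu_two_positions (T : finType) (n : nat) (w : {ffun 'I_n -> T} -> T)
    (r : equiv_rel T) (b t : T) (p : T -> T -> T) :
  is_wnu w -> ~~ r b t -> meet_pol (alg1 w) r b t p ->
  exists i0 i1 : 'I_n, i1 != i0.
Proof.
case: n w => [|[|n]] w [wid _] nbt.
- have wE (x y : T) : x = y.
    by rewrite -(wid x) -(wid y); congr w; apply/ffunP => -[].
  by rewrite (wE b t) equiv_refl in nbt.
- case=> [[u pu] _ pbt ptb ptt].
  have [v uv] : exists v, forall e, eval e u = e v.
    elim: u {pu} => [v|s ts IH]; first by exists v.
    have [v tv] := IH ord0; exists v => e /=; rewrite -tv.
    by rewrite -[RHS]wid; congr w; apply/ffunP=> i; rewrite !ffunE ord1.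
  have pE x y : p x y = match v with
      | inl i => [ffun i : 'I_2 => if i == ord0 then x else y] i
      | inr c => c end.
    by have := pu [ffun i => if i == ord0 then x else y]; rewrite uv /binop !ffunE.
  case/negP: nbt; move: pbt ptb ptt; rewrite !pE; case: v {uv pE} => [i|c].
    rewrite !ffunE; case: eqP => _ h1 h2 _; last by rewrite equiv_sym.
    by rewrite equiv_sym.
  by move=> cb _ ct; rewrite -(equiv_left _ cb).
- by move=> _; exists ord0, ord_max.
Qed.

(** * From minimal sets and the given order to the polynomial order *)

Section TypeFive.
Variables (T : finType) (A : algebra T) (r : equiv_rel T).
Hypothesis max_r : is_maximal_congruence A r.

Let cr : is_congruence A r. Proof. by case: max_r. Qed.

Lemma minimal_set_separates U :
  is_minimal_set A r (one_cong T) U -> separates_into A r U.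
Proof.
move=> [[f [pf -> [x [y [_ nf]]]]] _]; apply: maximal_separation max_r _.
exists f; last by exists x, y.
by split=> // z; apply/imsetP; exists z.
Qed.

Lemma class_belowP (c1 c2 : {eq_quot r}) : class_below A c1 c2 ->
  exists U u1 u2,
    [/\ separates_into A r U, forall x, x \in U -> r x u1 \/ r x u2,
        meet_range A r U u1 u2, exists p, meet_pol A r u1 u2 p
      & [/\ ~~ r u1 u2, r u1 (repr c1) & r u2 (repr c2)]].
Proof.
move=> [U [m [minU mU [u1 [u2 [c1E c2E n12 mu]]]]]].
have nu : ~~ r (val u1) (val u2).
  by apply/negP => u12; apply: n12; rewrite c1E c2E; apply/eqmodP.
exists U, (val u1), (val u2); split.
- exact: minimal_set_separates.
- exact: (induced_range mU nu).
- exact: (induced_meet_range cr mU nu mu).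
- exact: (induced_meet_pol cr mU mu).
- by split=> //; rewrite ?c1E ?c2E; apply/eqmodP; rewrite reprK.
Qed.

Lemma class_below_pol_edge U b t p (c1 c2 : {eq_quot r}) :
  separates_into A r U -> (forall x, x \in U -> r x b \/ r x t) ->
  ~~ r b t -> meet_pol A r b t p ->
  class_below A c1 c2 -> pol_edge A r b t (repr c1) (repr c2).
Proof.
move=> sepU rangeU nbt pp /class_belowP.
move=> [V [u1 [u2 [sepV rangeV meetV _ [nu uc1 uc2]]]]].
have [h [ph hV nh]] := sepV _ _ nbt.
have [f [pf fb ft]] := pol_edge_of_meet cr sepU rangeU pp rangeV nu meetV ph hV nh.
by exists f; split=> //; [exact: equiv_trans fb uc1|exact: equiv_trans ft uc2].
Qed.

Lemma class_le_pol_le U b t p (c d : {eq_quot r}) :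
  separates_into A r U -> (forall x, x \in U -> r x b \/ r x t) ->
  ~~ r b t -> meet_pol A r b t p ->
  class_le A c d -> pol_le A r b t (repr c) (repr d).
Proof.
move=> sepU rangeU nbt pp; elim=> [{}c {}d|{}c|x y z _ xy _ yz].
- by move=> cd; apply: pol_edge_le; exact: (class_below_pol_edge sepU rangeU nbt pp cd).
- exact: pol_le_refl.
- exact: pol_le_trans xy yz.
Qed.

(** With no generating pair the order is equality, so a largest class would be the only class,
    contradicting that [r] is proper. *)
Lemma largest_class_below :
  has_largest_class A r -> exists c d : {eq_quot r}, class_below A c d.
Proof.
move=> [c ctop]; apply: contrapT => nb; have [_ nr _] := max_r.
apply: nr => x y /=.
have le_eq (d e : {eq_quot r}) : class_le A d e -> d = e.
  elim=> [{}d {}e de|//|? ? ? _ -> _ ->//].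
  by case: nb; exists d, e.
apply/eqmodP; rewrite (le_eq _ _ (ctop (\pi_{eq_quot r} x))).
by rewrite -(le_eq _ _ (ctop (\pi_{eq_quot r} y))).
Qed.

End TypeFive.

Theorem theorem3p9 (T : finType) (n : nat) (w : {ffun 'I_n -> T} -> T)
    (r : equiv_rel T)
    (wnu_w : is_wnu w)
    (max_r : is_maximal_congruence (alg1 w) r)
    (ab_r : is_abelian_congruence (alg1 w) r)
    (typ_r : has_type5 (alg1 w) r (one_cong T))
    (top_r : has_largest_class (alg1 w) r) :
  exists m : T -> T -> T,
    [/\ is_term_op (alg1 w) (binop m),
        is_semilattice (quot_binop (r := r) m)
      & forall x y : T, r x y -> m x y = y].
Proof.
have [c0 [d0 /(class_belowP max_r)]] := largest_class_below max_r top_r.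
move=> [U [b [t [sepU rangeU meetU [p pp] [nbt _ _]]]]].
have [cr _ _] := max_r.
have [i0 [i1 i10]] := wnu_two_positions wnu_w nbt pp.
have [c ctop] := top_r.
have atop x : pol_le (alg1 w) r b t x (repr c).
  apply: pol_le_trans (class_le_pol_le max_r sepU rangeU nbt pp (ctop (\pi x))).
  by apply: pol_le_eqv; apply/eqmodP; rewrite reprK.
(* The exponent is positive, as the meet property requires, and divisible by every cycle length, as
   the projection property requires. *)
exists (fun x y => iter #|T|`! (wnu2 w i0 x) y); split.
- exact: term_op_iter_wnu2.
- exact: (iter_wnu2_semilattice wnu_w cr sepU rangeU meetU atop i10 (fact_gt0 _)).
- exact: iter_wnu2_id.
Qed.
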